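(* Let $A(t), B(t), C(t)$ be continuous complex $n\times n$ matrix-valued functions on $[t_0;+\infty)$ with $B(t)=B^*(t)$, $C(t)=C^*(t)$ for $t\ge t_0$, let $\mu(t)$ be a real-valued continuous function on $[t_0;+\infty)$, and let $[a;b]\subset[t_0;+\infty)$. Suppose that: 1) $B(t)\ge 0$ for $t\in[a;b]$; 4) the matrix equation $$B(t)X+XB(t)=2\mu(t)I-A(t)-A^*(t)$$ has a continuously differentiable hermitian solution $X=S(t)$ on $[a;b]$; 5) with $D_S(t)= S'(t)+S(t)B(t)S(t)+A^*(t)S(t)+S(t)A(t)-C(t)$, the scalar system $$\phi'=\mu(t)\phi+\frac{\lambda(B(t))}{n}\psi,\qquad \psi'=-\operatorname{tr}(D_S(t))\phi-\mu(t)\psi,\qquad t\in[a;b],$$ is oscillatory on $[a;b]$. Then the hamiltonian system $$\Phi'=A(t)\Phi+B(t)\Psi,\qquad \Psi'=C(t)\Phi-A^*(t)\Psi,\qquad t\ge t_0,$$ is also oscillatory on $[a;b]$.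
   Context: $M^*$ denotes the conjugate transpose of $M$, $I$ the $n\times n$ identity matrix. In the hamiltonian system $\Phi,\Psi$ are unknown continuously differentiable complex $n\times n$ matrix-functions on $[t_0;+\infty)$. A solution $(\Phi,\Psi)$ is called prepared if $\Phi^*(t)\Psi(t)=\Psi^*(t)\Phi(t)$ for $t\ge t_0$. A prepared solution is oscillatory on $[a;b]$ if $\det\Phi(t)$ vanishes at some point of $[a;b]$. The hamiltonian system is oscillatory on $[a;b]$ if every prepared solution is oscillatory on $[a;b]$. A real scalar linear system in unknowns $(\phi,\psi)$ is oscillatory on $[a;b]$ if for every (real) solution $(\phi,\psi)$ the function $\phi$ vanishes at some point of $[a;b]$. For a hermitian matrix $H$, $\lambda(H)$ is its least eigenvalue, and $H\ge0$ means $H$ is non-negative definite. *)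

(* Defs.v *)
From HB Require Import structures.
From mathcomp Require Import all_boot all_order all_algebra.
From mathcomp Require Import complex.
From mathcomp Require Import all_classical all_reals all_analysis.

Set Implicit Arguments.
Unset Strict Implicit.
Unset Printing Implicit Defensive.

Import Order.TTheory GRing.Theory Num.Theory.
Import numFieldNormedType.Exports.

Local Open Scope classical_set_scope.
Local Open Scope complex_scope.
Local Open Scope sesquilinear_scope.
Local Open Scope ring_scope.

(* Derivative of [f] at [x] relative to [D]: the difference quotient is taken
   along points of [D] only, hence it is one-sided at an endpoint of an
   interval. *)
Definition is_derive_in {R : realType} (D : set R) (f : R -> R) (x l : R) :
    Prop :=
  (f y - f x) / (y - x) @[y --> within D x^'] --> l.

Definition mx_is_derive_in {R : realType} (m n : nat) (D : set R)
    (F : R -> 'M[R[i]]_(m, n)) (x : R) (L : 'M[R[i]]_(m, n)) : Prop :=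
  forall i j,
    is_derive_in D (fun t => complex.Re (F t i j)) x (complex.Re (L i j)) /\
    is_derive_in D (fun t => complex.Im (F t i j)) x (complex.Im (L i j)).

Definition mx_continuous_in {R : realType} (m n : nat) (D : set R)
    (F : R -> 'M[R[i]]_(m, n)) : Prop :=
  forall i j,
    {within D, continuous (fun t => complex.Re (F t i j))} /\
    {within D, continuous (fun t => complex.Im (F t i j))}.

(* [F] is continuously differentiable on [D] with derivative [F']. *)
Definition mx_C1_in {R : realType} (m n : nat) (D : set R)
    (F F' : R -> 'M[R[i]]_(m, n)) : Prop :=
  (forall t, D t -> mx_is_derive_in D F t (F' t)) /\ mx_continuous_in D F'.

(* The order on [R[i]] is partial: [0 <= z] says that [z] is real and
   nonnegative. *)
Definition nonneg_definite {R : realType} (n : nat) (H : 'M[R[i]]_n) : Prop :=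
  forall v : 'cV[R[i]]_n, 0 <= (v ^t* *m H *m v) 0 0.

(* Meant for hermitian [H] with [0 < n]: its eigenvalues are then all real and
   form a finite nonempty set, so that the infimum is a minimum. *)
Definition least_eigenvalue {R : realType} (n : nat) (H : 'M[R[i]]_n) : R :=
  inf [set x : R | eigenvalue H x%:C].

Definition ham_solution {R : realType} (n : nat) (t0 : R)
    (A B C Phi Psi : R -> 'M[R[i]]_n) : Prop :=
  mx_C1_in `[t0, +oo[ Phi (fun t => A t *m Phi t + B t *m Psi t) /\
  mx_C1_in `[t0, +oo[ Psi (fun t => C t *m Phi t - (A t) ^t* *m Psi t).

Definition prepared {R : realType} (n : nat) (t0 : R)
    (Phi Psi : R -> 'M[R[i]]_n) : Prop :=
  forall t, t0 <= t -> (Phi t) ^t* *m Psi t = (Psi t) ^t* *m Phi t.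

Definition ham_oscillatory {R : realType} (n : nat) (t0 : R)
    (A B C : R -> 'M[R[i]]_n) (a b : R) : Prop :=
  forall Phi Psi : R -> 'M[R[i]]_n,
    ham_solution t0 A B C Phi Psi -> prepared t0 Phi Psi ->
    exists2 t, t \in `[a, b] & \det (Phi t) = 0.

(* The system [phi' = p phi + q psi], [psi' = r phi + s psi] on [[a; b]]. *)
Definition scalar_solution {R : realType} (a b : R) (p q r s phi psi : R -> R) :
    Prop :=
  forall t, t \in `[a, b] ->
    is_derive_in `[a, b] phi t (p t * phi t + q t * psi t) /\
    is_derive_in `[a, b] psi t (r t * phi t + s t * psi t).

Definition scalar_oscillatory {R : realType} (a b : R) (p q r s : R -> R) :
    Prop :=
  forall phi psi : R -> R, scalar_solution a b p q r s phi psi ->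
    exists2 t, t \in `[a, b] & phi t = 0.

(* [dS] stands for the derivative of [S]. *)
Definition D_mx {R : realType} (n : nat) (A B C S dS : R -> 'M[R[i]]_n)
    (t : R) : 'M[R[i]]_n :=
  dS t + S t *m B t *m S t + (A t) ^t* *m S t + S t *m A t - C t.

(* Main.v *)
(* If [det Phi] has no zero on [a; b], then [Y = Psi Phi^-1] is hermitian and
   solves the matrix Riccati equation [Y' + Y B Y + A^* Y + Y A = C].  For
   [Z = Y - S] the hypothesis on [S] collapses the terms linear in [Z] of the
   traced equation to [2 mu tr Z], whence, for [z = tr Z],
     [z' + 2 mu z + tr (Z B Z) + tr D_S = 0],
   and [tr (Z B Z) >= lambda(B) tr (Z^2) >= (lambda(B) / n) z^2].
   A function [z] satisfying the scalar Riccati inequality yields a solution of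
   the scalar linear system with [phi > 0]: in suitable coordinates the system
   reads [u' = alpha v], [v' = beta u] with [alpha], [beta] nonnegative, and the
   solutions with initial value [1], obtained as monotone limits of Picard
   iterates, stay at least [1].  This contradicts the oscillation of the scalar
   system. *)
Require Import Defs.
From mathcomp Require Import all_boot all_order all_algebra.
From mathcomp Require Import complex.
From mathcomp Require Import all_classical all_reals all_analysis.
From mathcomp Require Import measurable_realfun.
From mathcomp Require Import ring lra.

Import Order.TTheory GRing.Theory Num.Theory.
Import numFieldNormedType.Exports.

Local Open Scope classical_set_scope.
Local Open Scope complex_scope.
Local Open Scope sesquilinear_scope.
Local Open Scope ring_scope.

(** * Linear systems with nonnegative coefficients *)

Section linear_system.
Context {R : realType}.
Notation mu := (@lebesgue_measure R).
Implicit Types (c d t : R) (f h : R -> R).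

(** Shows that [expR (M * (t - c))] is a fixed point of the Picard operator with constant
    coefficient [M]; it serves as majorant of the iterates. *)
Lemma Rintegral_expR c d (M : R) : c <= d ->
  \int[mu]_(s in `[c, d]) (M * expR (M * (s - c))) = expR (M * (d - c)) - 1.
Proof.
rewrite le_eqVlt => /predU1P[<-|cd].
  by rewrite set_itv1 Rintegral_set1 subrr mulr0 expR0 subrr.
pose F (s : R) := expR (M * (s - c)).
have dF (s : R) : is_derive s 1 F (M * expR (M * (s - c))).
  rewrite /F.
  have : is_derive s 1 (fun s : R => M * (s - c)) (M *: (1 - 0)).
    exact: is_deriveZ.
  rewrite subr0 scaler1 => dM.
  have := @is_derive1_comp _ expR (fun s : R => M * (s - c)) s _ _ (is_derive_expR _) dM.
  by rewrite mulrC.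
have cF : continuous F.
  by move=> s; apply: differentiable_continuous; apply/derivable1_diffP; case: (dF s).
rewrite /Rintegral (@continuous_FTC2 _ _ F) //=.
- by rewrite /F subrr mulr0 expR0.
- apply: continuous_subspaceT => s; apply: cvgM; first exact: cvg_cst.
  exact: cF.
- split.
  + by move=> s _; case: (dF s).
  + exact/cvg_at_right_filter/cF.
  + exact/cvg_at_left_filter/cF.
- by move=> s _; rewrite derive1E; have /@derive_val := dF s.
Qed.

Lemma integrable_subitv c d t h : {within `[c, d], continuous h} -> t <= d ->
  mu.-integrable `[c, t] (EFin \o h).
Proof.
move=> ch td; apply: continuous_compact_integrable.
  exact: segment_compact.
apply: continuous_subspaceW ch; apply: subset_itvl; exact: td.
Qed.

Lemma within_continuousM (D : set R) (f g : R -> R) :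
  {within D, continuous f} -> {within D, continuous g} ->
  {within D, continuous (fun x => f x * g x)}.
Proof.
by move=> cf cg x; exact: (cvgM (cf x) (cg x)).
Qed.

(** The limit [h] is measurable as a pointwise limit and dominated by the constant [M], integrable
    on a segment. Its integrability is part of the conclusion because continuity of the Picard limit
    is deduced from it. *)
Lemma cvg_Rintegral_dominated c d (h_ : nat -> R -> R) h (M : R) :
  (forall k, {within `[c, d], continuous (h_ k)}) ->
  (forall t, t \in `[c, d] -> h_ ^~ t @ \oo --> h t) ->
  (forall k t, t \in `[c, d] -> `|h_ k t| <= M) ->
  mu.-integrable `[c, d] (EFin \o h) /\
  \int[mu]_(t in `[c, d]) h_ k t @[k --> \oo] --> \int[mu]_(t in `[c, d]) h t.
Proof.
move=> ch hh hM.
have ih k : mu.-integrable `[c, d] (EFin \o h_ k).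
  by apply: (@integrable_subitv _ d).
have mh_ k : measurable_fun `[c, d] (h_ k).
  by move: (ih k) => /integrableP[/measurable_EFinP].
have mh : measurable_fun `[c, d] h by apply: measurable_fun_cvg mh_ hh.
have iM : mu.-integrable `[c, d] (EFin \o cst M).
  apply: (@integrable_subitv _ d) => //.
  by apply: continuous_subspaceT => x; exact: cvg_cst.
have ih' : mu.-integrable `[c, d] (EFin \o h).
  apply: le_integrable iM => //.
    exact/measurable_EFinP.
  move=> t tcd /=; rewrite lee_fin [leRHS]ger0_norm; last first.
    by rewrite (le_trans _ (hM 0%N t tcd)).
  have /cvg_norm/cvg_lim <- // := hh _ tcd.
  apply: limr_le; first by apply: is_cvg_norm; apply/cvg_ex; exists (h t); exact: hh.
  by apply: nearW => k; exact: hM.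
split=> //; apply: fine_cvg.
rewrite fineK; last exact: integrable_fin_num.
apply: (dominated_cvg _ _ _ _ iM) => //.
- by move=> k; exact: measurable_int (ih k).
- by move=> t tcd; apply/fine_cvgP; split; [exact: nearW|exact: hh].
Qed.

(** * Picard iteration for two coupled linear equations *)

Section picard.
Variables (c d : R) (g : bool -> R -> R).
Hypothesis cd : c < d.
Hypothesis cg : forall i, continuous (g i).
Hypothesis g0 : forall i t, 0 <= g i t.

(** The boolean indexes the two unknowns of the system [f true' = g true * f false],
    [f false' = g false * f true], both with value 1 at [c]; [~~ i] is the other unknown. *)
Fixpoint picard k (i : bool) (t : R) : R :=
  if k is k'.+1 then
    1 + \int[mu]_(s in `[c, t]) (g i s * picard k' (~~ i) s)
  else 1.

Lemma primitive_continuous h : mu.-integrable `[c, d] (EFin \o h) ->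
  {within `[c, d], continuous (fun t => 1 + \int[mu]_(s in `[c, t]) h s)}.
Proof.
move=> ih; have ci := parameterized_integral_continuous (ltW cd) ih.
move=> t; exact: (cvgD (cvg_cst _) (ci t)).
Qed.

Lemma picard_continuous k i : {within `[c, d], continuous (picard k i)}.
Proof.
elim: k i => [|k IH] i; first by move=> t; exact: cvg_cst.
apply: primitive_continuous; apply: (@integrable_subitv _ d) => //.
by apply: within_continuousM => //; apply: continuous_subspaceT; exact: cg.
Qed.

Lemma picard_integrand_continuous k i :
  {within `[c, d], continuous (fun s => g i s * picard k (~~ i) s)}.
Proof.
apply: within_continuousM; last exact: picard_continuous.
by apply: continuous_subspaceT; exact: cg.
Qed.

Lemma subitv_in {t s : R} : t \in `[c, d] -> s \in `[c, t] -> s \in `[c, d].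
Proof. by rewrite !in_itv/= => /andP[_ td] /andP[-> st]; exact: le_trans td. Qed.

Lemma picard_ge1 k i t : t \in `[c, d] -> 1 <= picard k i t.
Proof.
elim: k i t => [|k IH] i t tcd //=.
rewrite lerDl; apply: Rintegral_ge0 => s sct; rewrite mulr_ge0 //.
by rewrite (le_trans ler01) // IH // (subitv_in tcd).
Qed.

(** As the [g i] are nonnegative, the integral operator preserves order, so the inequality between
    the first two iterates propagates. *)
Lemma picard_le k i t : t \in `[c, d] -> picard k i t <= picard k.+1 i t.
Proof.
elim: k i t => [|k IH] i t tcd.
  exact: (picard_ge1 1).
have td : t <= d by move: tcd; rewrite in_itv => /andP[].
rewrite /= lerD2l; apply: le_Rintegral => //.
- by apply: (@integrable_subitv _ d) => //; exact: picard_integrand_continuous.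
- apply: (@integrable_subitv _ d) => //.
exact: (picard_integrand_continuous k.+1 i).
- by move=> s sct; rewrite ler_wpM2l // IH // (subitv_in tcd).
Qed.

(** One [M] bounds both coefficients on the segment. The exponential solves the integral equations
    with both coefficients replaced by [M], hence dominates every iterate by induction. *)
Lemma picard_bounded : exists M, 0 <= M /\
  forall k i t, t \in `[c, d] ->
    [/\ g i t <= M & picard k i t <= expR (M * (t - c))].
Proof.
have [M gM] : exists M, forall i t, t \in `[c, d] -> g i t <= M.
  have H i : exists M, forall t, t \in `[c, d] -> g i t <= M.
    have [|x _ xM] := @EVT_max _ (g i) c d (ltW cd).
      by apply: continuous_subspaceT; exact: cg.
    by exists (g i x).
  have [[M1 H1] [M2 H2]] := (H true, H false).
  exists (Num.max M1 M2) => -[] t tcd; rewrite le_max.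
    by rewrite H1.
  by rewrite H2 // orbT.
have cc : c \in `[c, d] by rewrite bound_itvE ltW.
have M0 : 0 <= M := le_trans (g0 true c) (gM true c cc).
exists M; split=> // k i t tcd; split; first exact: gM.
elim: k i t tcd => [|k IH] i t tcd.
  rewrite /= -expR0 ler_expR mulr_ge0 // subr_ge0.
  by move: tcd; rewrite in_itv => /andP[].
have [ct td] : c <= t /\ t <= d by move: tcd; rewrite in_itv => /andP[].
rewrite /= -lerBrDl -(@Rintegral_expR c) //; apply: le_Rintegral => //.
- by apply: (@integrable_subitv _ d) => //; exact: picard_integrand_continuous.
- apply: (@integrable_subitv _ d) => //; apply: continuous_subspaceT => s.
  apply: cvgM; first exact: cvg_cst.
  apply: continuous_comp; last exact: continuous_expR.
  apply: cvgM; first exact: cvg_cst.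
  by apply: cvgB; [exact: cvg_id|exact: cvg_cst].
- move=> s sct; have scd : s \in `[c, d] by exact: subitv_in sct.
  apply: ler_pM => //; [|exact: gM|exact: IH].
  by rewrite (le_trans ler01) // picard_ge1.
Qed.

(** The iterates increase and are bounded, so they converge; dominated convergence carries the
    integral equations to the limit, and the fundamental theorem of calculus differentiates them at
    interior points. *)
Lemma linear_system_solution : exists f : bool -> R -> R,
  forall i t, t \in `]c, d[ ->
    is_derive t 1 (f i) (g i t * f (~~ i) t) /\ 1 <= f i t.
Proof.
have [M [M0 HM]] := picard_bounded.
pose f i t := limn (picard ^~ i ^~ t).
have cf i t : t \in `[c, d] -> picard ^~ i ^~ t @ \oo --> f i t.
  move=> tcd; apply: nondecreasing_is_cvgn.
    by apply/nondecreasing_seqP => k; exact: picard_le.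
  by exists (expR (M * (t - c))) => _ [k _ <-]; have [] := HM k i t tcd.
have f1 i t : t \in `[c, d] -> 1 <= f i t.
  move=> tcd; apply: limr_ge; first by apply/cvg_ex; exists (f i t); exact: cf.
  by apply: nearW => k; exact: picard_ge1.
have key i t : t \in `[c, d] ->
    mu.-integrable `[c, t] (EFin \o (fun s => g i s * f (~~ i) s)) /\
    \int[mu]_(s in `[c, t]) (g i s * picard k (~~ i) s) @[k --> \oo] -->
    \int[mu]_(s in `[c, t]) (g i s * f (~~ i) s).
  move=> tcd; have td : t <= d by move: tcd; rewrite in_itv => /andP[].
  (* The dominating constant is the bound of [g i] times the value at [d] of the increasing
     majorant. *)
  apply: (@cvg_Rintegral_dominated _ _ _ _ (M * expR (M * (d - c)))).
  - move=> k; apply: continuous_subspaceW (picard_integrand_continuous k i).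
    exact: subset_itvl.
  - move=> s sct; apply: cvgM; first exact: cvg_cst.
    exact: cf (subitv_in tcd sct).
  - move=> k s sct; have scd := subitv_in tcd sct.
    have [gM pM] := HM k i s scd; have [_ pM'] := HM k (~~ i) s scd.
    have p0 : 0 <= picard k (~~ i) s by rewrite (le_trans ler01) // picard_ge1.
    rewrite ger0_norm ?mulr_ge0 // ler_pM // (le_trans pM') // ler_expR.
    rewrite ler_wpM2l // lerD2r.
    by move: scd; rewrite in_itv => /andP[].
have fE i t : t \in `[c, d] ->
    f i t = 1 + \int[mu]_(s in `[c, t]) (g i s * f (~~ i) s).
  move=> tcd; have [_ cI] := key i t tcd.
  have h1 : picard k.+1 i t @[k --> \oo] -->
      1 + \int[mu]_(s in `[c, t]) (g i s * f (~~ i) s).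
    by apply: cvgD => //; exact: cvg_cst.
  have h2 : picard k.+1 i t @[k --> \oo] --> f i t.
    by have := cf i t tcd; rewrite -cvg_shiftS.
  exact: cvg_unique h2 h1.
have dd : d \in `[c, d] by rewrite bound_itvE ltW.
(* A pointwise limit need not be continuous; here continuity comes from the integral equation, whose
   right-hand side is a primitive. *)
have ctf i : {within `[c, d], continuous (f i)}.
  have := primitive_continuous _ (proj1 (key i d dd)).
  by apply: subspace_eq_continuous => t; rewrite inE => tcd; rewrite [RHS]fE.
exists f => i t tcd; have tcd' : t \in `[c, d] by exact: subset_itv_oo_cc tcd.
split; last exact: f1.
have [ct td] : c < t /\ t < d by move: tcd; rewrite in_itv => /andP[].
have cgf : {for t, continuous (fun s => g i s * f (~~ i) s)}.
  apply: cvgM; first exact: cg.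
  exact: (@within_continuous_continuous _ _ _ c d).
have [dI I'] := @continuous_FTC1_closed _ _ _ _ _ td (proj1 (key i d dd)) ct cgf.
have dI' : is_derive t 1 (fun t => \int[mu]_(s in `[c, t]) (g i s * f (~~ i) s))
    (g i t * f (~~ i) t).
  by apply: DeriveDef; [exact: dI|rewrite -derive1E; exact: I'].
have dI1 : is_derive t 1 (fun t => 1 + \int[mu]_(s in `[c, t]) (g i s * f (~~ i) s))
    (g i t * f (~~ i) t).
  by rewrite -[X in is_derive _ _ _ X]add0r; exact: is_deriveD.
apply: near_eq_is_derive dI1.
have := near_in_itvoo tcd.
by apply: filterS => s scd; rewrite fE //; exact: subset_itv_oo_cc scd.
Qed.

End picard.
End linear_system.

(** * The scalar Riccati inequality *)

Section derive_in.
Context {R : realType}.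
Implicit Types (D : set R) (f g : R -> R) (x l m : R).

(** By Caratheodory's characterization the difference quotient agrees, away from [x], with a
    function continuous at [x] whose value there is [l]. *)
Lemma is_derive_is_derive_in D f x l : is_derive x 1 f l -> is_derive_in D f x l.
Proof.
move=> df; have [/(_ df)[g [gE cg <-]] _] := is_derive1_caratheodory f x l.
apply: (@cvg_within_filter _ _ _ x^').
have cg' : g y @[y --> x^'] --> g x by apply: cvg_within_filter cg.
apply: cvg_trans cg'; apply: near_eq_cvg; near=> y.
have yx : y - x != 0 by rewrite subr_eq0; near: y; exact: nbhs_dnbhs_neq.
by rewrite gE mulfK.
Unshelve. all: by end_near. Qed.

Lemma is_derive_inW D D' f x l : D `<=` D' ->
  is_derive_in D' f x l -> is_derive_in D f x l.
Proof.
move=> DD' df; apply: cvg_trans df; apply: cvg_fmap2; exact: within_subset.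
Qed.

Lemma is_derive_in_cvg D f x l : is_derive_in D f x l ->
  f y @[y --> within D x^'] --> f x.
Proof.
move=> df.
have h : ((f y - f x) / (y - x)) * (y - x) + f x @[y --> within D x^'] -->
    l * (x - x) + f x.
  apply: cvgD; last exact: cvg_cst.
  apply: cvgM; first exact: df.
  apply: cvgB; last exact: cvg_cst.
  apply: (@cvg_within_filter _ _ _ x^').
  by apply: cvg_within_filter; exact: cvg_id.
rewrite subrr mulr0 add0r in h; apply: cvg_trans h.
apply: near_eq_cvg.
have yx : \forall y \near within D x^', y != x.
  apply: (@cvg_within _ x^'); near=> y.
  by near: y; exact: nbhs_dnbhs_neq.
by apply: filterS yx => y yx; rewrite divfK ?subr_eq0 // subrK.
Unshelve. all: by end_near. Qed.

Lemma is_derive_in_continuous D f x l : is_derive_in D f x l ->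
  f y @[y --> within D (nbhs x)] --> f x.
Proof.
move=> /is_derive_in_cvg cf P Px.
have cf' : \forall y \near x, y != x -> D y -> P (f y) by exact: cf P Px.
change (\forall y \near x, D y -> P (f y)).
apply: filterS cf' => y Py Dy; have [->|yx] := eqVneq y x; first exact: nbhs_singleton.
exact: Py.
Qed.

Lemma is_derive_inD D f g x l m :
  is_derive_in D f x l -> is_derive_in D g x m ->
  is_derive_in D (fun t => f t + g t) x (l + m).
Proof.
move=> df dg; rewrite /is_derive_in.
under eq_fun do rewrite opprD addrACA mulrDl.
exact: cvgD.
Qed.

Lemma is_derive_inM D f g x l m :
  is_derive_in D f x l -> is_derive_in D g x m ->
  is_derive_in D (fun t => f t * g t) x (l * g x + f x * m).
Proof.
move=> df dg; have cg := is_derive_in_cvg _ _ _ _ dg.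
have E y : (f y * g y - f x * g x) / (y - x) =
    (f y - f x) / (y - x) * g y + f x * ((g y - g x) / (y - x)) by ring.
rewrite /is_derive_in; under eq_fun do rewrite E.
by apply: cvgD; apply: cvgM => //; exact: cvg_cst.
Qed.

Lemma eq_is_derive_in D f x l m : l = m -> is_derive_in D f x l -> is_derive_in D f x m.
Proof. by move=> ->. Qed.

(** Precomposes [f] with the clamping of the line onto [[a, b]]. The last clause transfers sign
    conditions from [f] to the extension. *)
Lemma continuous_extension (a b : R) f : a <= b ->
  {within `[a, b], continuous f} ->
  exists g, [/\ continuous g, forall t, t \in `[a, b] -> g t = f t &
    forall t, exists2 s, s \in `[a, b] & g t = f s].
Proof.
move=> ab /subspace_continuousP cf.
pose c t := Num.max a (Num.min b t).
have cin t : c t \in `[a, b].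
  by rewrite in_itv /= /c le_max lexx /= ge_max ab ge_min lexx.
exists (f \o c); split.
- move=> t; apply: cvg_comp (cf (c t) (cin t)).
  have cc : c y @[y --> t] --> c t.
    apply: (@continuous_max _ _ (cst a)); first exact: cvg_cst.
    by apply: continuous_min; [exact: cvg_cst|exact: cvg_id].
  move=> P /cc; rewrite /= !nbhs_simpl /=; apply: filterS => y; apply; exact: cin.
- move=> t /[!in_itv]/= /andP[at_ tb]; rewrite /= /c.
  by rewrite (min_idPr tb) (max_idPr at_).
- by move=> t; exists (c t).
Qed.

(** Integrating an extension of [f] from [a - 1] makes every point of [[a, b]] interior, so the
    derivative is two-sided even at the endpoints. *)
Lemma primitive_in (a b : R) f : a <= b -> {within `[a, b], continuous f} ->
  exists F : R -> R, forall t, t \in `[a, b] -> is_derive t 1 F (f t).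
Proof.
move=> ab cf; have [g [cg gE _]] := continuous_extension a b f ab cf.
exists (fun t => \int[lebesgue_measure]_(s in `[a - 1, t]) g s) => t tab.
have [at_ tb] : a <= t /\ t <= b by move: tab; rewrite in_itv => /andP[].
have tu : t < t + 1 by rewrite ltrDl.
have ig : lebesgue_measure.-integrable `[a - 1, t + 1] (EFin \o g).
  by apply: (@integrable_subitv _ _ (t + 1)) => //; exact: continuous_subspaceT.
have a1t : a - 1 < t by lra.
have [dI I'] := @continuous_FTC1_closed _ _ _ _ _ tu ig a1t (cg t).
by apply: DeriveDef; [exact: dI|rewrite -derive1E -gE //; exact: I'].
Qed.

(* With [E = exp (int (p + q z))], the substitution [phi = E u],
   [psi - z phi = v / E] turns the system into [u' = (q / E^2) v],
   [v' = (e E^2) u], to which [linear_system_solution] applies. *)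
Lemma riccati_inequality_positive_solution (a b : R) (p q d z e : R -> R) :
  a <= b ->
  {within `[a, b], continuous p} -> {within `[a, b], continuous q} ->
  {within `[a, b], continuous e} ->
  (forall t, t \in `[a, b] -> 0 <= q t) -> (forall t, t \in `[a, b] -> 0 <= e t) ->
  (forall t, t \in `[a, b] ->
    is_derive_in `[a, b] z t (- (2 * p t * z t) - q t * z t ^+ 2 - d t - e t)) ->
  exists phi psi,
    scalar_solution a b p q (fun t => - d t) (fun t => - p t) phi psi /\
    forall t, t \in `[a, b] -> 0 < phi t.
Proof.
move=> ab cp cq ce q0 e0 dz.
have cz : {within `[a, b], continuous z}.
  by apply/subspace_continuousP => t tab; apply: is_derive_in_continuous (dz t tab).
have cG : {within `[a, b], continuous (fun t => p t + q t * z t)}.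
  move=> t; apply: cvgD; first exact: cp.
  exact: (within_continuousM _ q z cq cz).
have [J dJ] := primitive_in a b _ ab cG.
have dE t : t \in `[a, b] ->
    is_derive t 1 (fun t => expR (J t)) ((p t + q t * z t) * expR (J t)).
  by move=> tab; rewrite mulrC; exact: (@is_derive1_comp _ expR J _ _ _ _ (dJ t tab)).
have dEN t : t \in `[a, b] ->
    is_derive t 1 (fun t => expR (- J t)) (- (p t + q t * z t) * expR (- J t)).
  move=> tab; have dJ' := is_deriveN (dJ t tab).
  by rewrite mulrC; exact: (@is_derive1_comp _ expR (- J) _ _ _ _ dJ').
have cE : {within `[a, b], continuous (fun t => expR (J t))}.
  apply: derivable_within_continuous => t tab.
  by case: (dE t tab).
have cEN : {within `[a, b], continuous (fun t => expR (- J t))}.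
  apply: derivable_within_continuous => t tab.
  by case: (dEN t tab).
have cal := within_continuousM _ _ _ cq (within_continuousM _ _ _ cEN cEN).
have cbe := within_continuousM _ _ _ ce (within_continuousM _ _ _ cE cE).
(* [linear_system_solution] asks for coefficients continuous and nonnegative on the whole line,
   hence the extensions. *)
have [al [alc alE alr]] := continuous_extension _ _ _ ab cal.
have [be [bec beE ber]] := continuous_extension _ _ _ ab cbe.
pose g (i : bool) := if i then al else be.
have cg i : continuous (g i) by case: i.
have g0 i t : 0 <= g i t.
  case: i; rewrite /g.
    by have [s sab ->] := alr t; rewrite mulr_ge0 ?q0 // mulr_ge0 ?expR_ge0.
  by have [s sab ->] := ber t; rewrite mulr_ge0 ?e0 // mulr_ge0 ?expR_ge0.
(* The margin of 1 puts the endpoints [a] and [b] inside the open interval where the solution is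
   differentiable. *)
have ab1 : a - 1 < b + 1 by lra.
have [w wP] := linear_system_solution _ _ g ab1 cg g0.
have inab t : t \in `[a, b] -> t \in `]a - 1, b + 1[.
  by rewrite !in_itv /= => /andP[? ?]; apply/andP; split; lra.
pose phi t := expR (J t) * w true t.
exists phi, (fun t => expR (- J t) * w false t + z t * phi t).
split; last first.
  move=> t /inab /(wP true)[_ w1].
  by rewrite mulr_gt0 ?expR_gt0 // (lt_le_trans ltr01).
move=> t tab.
have [/(is_derive_is_derive_in `[a, b]) du _] := wP true t (inab t tab).
have [/(is_derive_is_derive_in `[a, b]) dv _] := wP false t (inab t tab).
have /(is_derive_is_derive_in `[a, b]) dE' := dE t tab.
have /(is_derive_is_derive_in `[a, b]) dEN' := dEN t tab.
rewrite /= alE // in du; rewrite /= beE // in dv.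
have EK : expR (- J t) * expR (J t) = 1 by rewrite -expRD addNr expR0.
have dphi : is_derive_in `[a, b] phi t
    (p t * phi t + q t * (expR (- J t) * w false t + z t * phi t)).
  apply: eq_is_derive_in (is_derive_inM _ _ _ _ _ _ dE' du).
  rewrite /phi.
  (* Regrouping exposes the product of inverse exponentials, which [EK] cancels and [ring]
     cannot. *)
  have -> : expR (J t) * (q t * (expR (- J t) * expR (- J t)) * w false t)
    = (expR (- J t) * expR (J t)) * (q t * expR (- J t) * w false t) by ring.
  by rewrite EK; ring.
split=> //.
apply: eq_is_derive_in (is_derive_inD _ _ _ _ _ _ (is_derive_inM _ _ _ _ _ _ dEN' dv)
  (is_derive_inM _ _ _ _ _ _ (dz t tab) dphi)).
have -> : expR (- J t) * (e t * (expR (J t) * expR (J t)) * w true t)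
    = (expR (- J t) * expR (J t)) * (e t * phi t) by rewrite /phi; ring.
by rewrite EK; ring.
Qed.

End derive_in.

(** * The least eigenvalue of a hermitian matrix *)

Section least_eigenvalue.
Context {R : realType}.
Local Notation C := R[i].

Lemma Re_sum (I : Type) (r : seq I) (P : pred I) (F : I -> C) :
  complex.Re (\sum_(i <- r | P i) F i) = \sum_(i <- r | P i) complex.Re (F i).
Proof. by apply: (big_morph (@complex.Re R)) => // -[? ?] [? ?]. Qed.

Lemma Im_sum (I : Type) (r : seq I) (P : pred I) (F : I -> C) :
  complex.Im (\sum_(i <- r | P i) F i) = \sum_(i <- r | P i) complex.Im (F i).
Proof. by apply: (big_morph (@complex.Im R)) => // -[? ?] [? ?]. Qed.

Lemma cvg_sumr {T : Type} {F : set_system T} {FF : Filter F} (I : Type)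
    (r : seq I) (P : pred I) (f : I -> T -> R) (l : I -> R) :
  (forall i, P i -> f i x @[x --> F] --> l i) ->
  \sum_(i <- r | P i) f i x @[x --> F] --> \sum_(i <- r | P i) l i.
Proof. by move=> fl; apply: cvg_big => //; exact: add_continuous. Qed.

Lemma normc_real (x : R) : `|x%:C| = `|x|%:C :> C.
Proof. by rewrite normc_def /= expr0n /= addr0 sqrtr_sqr. Qed.

Lemma normc_le_ReIm (z : C) :
  `|z| <= (`|complex.Re z| + `|complex.Im z|)%:C.
Proof.
rewrite {1}[z]complexE; apply: (le_trans (ler_normD _ _)).
rewrite normrM !normc_real rmorphD /= lerD2l.
suff -> : `|'i%C| = 1 :> C by rewrite mul1r.
by rewrite normc_def /= expr0n /= expr1n add0r sqrtr1.
Qed.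

Lemma dot_rowE n (v : 'rV[C]_n) : (v *m v ^t*) 0 0 = \sum_i `|v 0 i| ^+ 2.
Proof. by rewrite mxE; apply: eq_bigr => i _; rewrite !mxE normCK. Qed.

Lemma dot_row_ge0 n (v : 'rV[C]_n) : 0 <= (v *m v ^t*) 0 0.
Proof. by rewrite dot_rowE sumr_ge0 // => i _; rewrite exprn_ge0. Qed.

Lemma dot_row_gt0 n (v : 'rV[C]_n) : v != 0 -> 0 < (v *m v ^t*) 0 0.
Proof.
move=> v0; rewrite lt_def dot_row_ge0 andbT dot_rowE.
apply: contra v0; rewrite psumr_eq0 => [/allP h|i _]; last by rewrite exprn_ge0.
apply/eqP/rowP => i; rewrite mxE.
by have := h i (mem_index_enum i); rewrite /= expf_eq0 /= normr_eq0 => /eqP.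
Qed.

(** Spectral theorem: in unitary coordinates the form is a sum of squared moduli weighted by the
    real diagonal entries. The smallest entry gives the Rayleigh bound, and the matching row of [P]
    is an eigenvector. *)
Lemma least_eigenvalueP n (H : 'M[C]_n) : (0 < n)%N -> H = H ^t* ->
  (exists2 v : 'rV[C]_n, v != 0 & v *m H = (least_eigenvalue H)%:C *: v) /\
  forall v : 'rV[C]_n,
    (least_eigenvalue H)%:C * (v *m v ^t*) 0 0 <= (v *m H *m v ^t*) 0 0.
Proof.
move=> n0 HH.
have Hh : H \is hermsymmx.
  by apply/is_hermitianmxP; rewrite expr0 scale1r -HH.
pose P := spectralmx H; pose sp := spectral_diag H.
have Pu : P \is unitarymx := spectral_unitarymx H.
have HE : H = P ^t* *m diag_mx sp *m P.
  rewrite -(invmx_unitary Pu).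
  by have /orthomx_spectralP := hermitian_normalmx Hh.
have spR i : sp 0 i = (complex.Re (sp 0 i))%:C.
  have /mxOverP/(_ 0 i) := hermitian_spectral_diag_real Hh.
  by move=> /RRe_real.
pose i0 : 'I_n := Ordinal n0.
have [im _ imin] := arg_minP (fun i => complex.Re (sp 0 i)) (isT : xpredT i0).
set l := complex.Re (sp 0 im) in imin *.
have ray (v : 'rV[C]_n) : l%:C * (v *m v ^t*) 0 0 <= (v *m H *m v ^t*) 0 0.
  pose w := v *m P ^t*.
  have wE : w ^t* = P *m v ^t* by rewrite /w trmx_mul map_mxM /= trmxCK.
  have -> : v *m v ^t* = w *m w ^t*.
    by rewrite wE /w mulmxA mulmxKtV.
  have -> : v *m H *m v ^t* = w *m diag_mx sp *m w ^t*.
    by rewrite wE /w HE !mulmxA.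
  rewrite dot_rowE mulr_sumr mxE; apply: ler_sum => i _.
  rewrite mul_mx_diag !mxE mulrAC -normCK mulrC ler_wpM2l ?exprn_ge0 //.
  by rewrite spR lecR imin.
have lev : exists2 v : 'rV[C]_n, v != 0 & v *m H = l%:C *: v.
  exists (row im P).
    apply/negP => /eqP r0; have : (P *m P ^t*) im im = 1.
      by rewrite (unitarymxP Pu) mxE eqxx.
    rewrite mxE big1 => [/esym/eqP|j _]; first by rewrite oner_eq0.
    by have /rowP/(_ j) := r0; rewrite !mxE => ->; rewrite mul0r.
  rewrite HE !mulmxA -row_mul (unitarymxP Pu) row1 -rowE row_diag_mx.
  by rewrite -scalemxAl -rowE -spR.
(* [l] is an eigenvalue, and the Rayleigh bound at any eigenvector makes it a lower bound of the
   real eigenvalues. *)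
have -> : least_eigenvalue H = l.
  have lset : [set x : R | eigenvalue H x%:C] l.
    by have [v v0 vH] := lev; apply/eigenvalueP; exists v.
  have lb : lbound [set x : R | eigenvalue H x%:C] l.
    move=> x /eigenvalueP[v vH v0]; have := ray v.
    by rewrite vH -scalemxAl [leRHS]mxE ler_pM2r ?dot_row_gt0 // lecR.
  apply/eqP; rewrite eq_le; apply/andP; split.
    by apply: ge_inf => //; exists l.
  by apply: lb_le_inf => //; exists l.
by [].
Qed.

(** At an eigenvector for the least eigenvalue, the form equals this eigenvalue times a positive
    number. *)
Lemma least_eigenvalue_ge0 n (H : 'M[C]_n) : (0 < n)%N -> H = H ^t* ->
  nonneg_definite H -> 0 <= least_eigenvalue H.
Proof.
move=> n0 HH Hnn; have [[v v0 vH] _] := least_eigenvalueP _ H n0 HH.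
have := Hnn (v ^t*); rewrite trmxCK vH -scalemxAl mxE.
by rewrite pmulr_lge0 ?dot_row_gt0 // ler0c.
Qed.

(** Tests the Rayleigh bound of [H] at a minimal eigenvector [v] of [K]: the form of [H - K] at [v]
    is at most the sum of its entry moduli times the squared norm of [v]. *)
Lemma least_eigenvalue_le n (H K : 'M[C]_n) : (0 < n)%N ->
  H = H ^t* -> K = K ^t* ->
  least_eigenvalue H <= least_eigenvalue K +
    \sum_i \sum_j (`|complex.Re (H i j - K i j)| + `|complex.Im (H i j - K i j)|).
Proof.
move=> n0 HH KK; have [_ /= ray] := least_eigenvalueP _ H n0 HH.
have [[v v0 vK] _] := least_eigenvalueP _ K n0 KK.
have N0 := dot_row_gt0 _ _ v0; set N := (v *m v ^t*) 0 0 in N0.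
rewrite -lecR -(ler_pM2r N0); apply: (le_trans (ray v)).
have vN i : `|v 0 i| ^+ 2 <= N.
  by rewrite /N dot_rowE (bigD1 i) // lerDl sumr_ge0.
have vvN i j : `|v 0 i| * `|v 0 j| <= N.
  have [ij|ji] := real_leP (normr_real (v 0 i)) (normr_real (v 0 j)).
    by apply: le_trans (vN j); rewrite expr2 ler_wpM2r.
  by apply: le_trans (vN i); rewrite expr2 ler_wpM2l // ltW.
have -> : v *m H *m v ^t* = v *m K *m v ^t* + v *m (H - K) *m v ^t*.
  by rewrite mulmxBr mulmxBl addrC subrK.
rewrite mxE vK -scalemxAl mxE rmorphD /= mulrDl lerD2l.
set z := (_ *m _ *m _) 0 0.
(* The order on complex numbers is partial, so [z <= |z|] requires [z] real. The form of [H] is real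
   because it is comparable with a real number. *)
have zr : z \is Num.real.
  have lr (M : R) : M%:C * N \is Num.real.
    by apply: realM; [apply/complex_realP; exists M|exact: gtr0_real].
  rewrite /z mulmxBr mulmxBl mxE [X in _ + X]mxE vK -scalemxAl [X in _ - X]mxE.
  by rewrite realB ?lr // -(ler_real (ray v)) lr.
apply: (le_trans (real_ler_norm zr)).
rewrite /z mxE; apply: (le_trans (ler_norm_sum _ _ _)).
rewrite exchange_big /= rmorph_sum /= mulr_suml; apply: ler_sum => j _.
rewrite normrM mxE rmorph_sum /= mulr_suml.
apply: (le_trans (ler_wpM2r (normr_ge0 _) (ler_norm_sum _ _ _))).
rewrite mulr_suml; apply: ler_sum => i _.
rewrite normrM !mxE norm_conjC mulrAC mulrC ler_pM ?mulr_ge0 //.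
exact: normc_le_ReIm.
Qed.

Lemma ler_dist_trans (r s k e : R) :
  k <= e -> s <= r + k -> r <= s + k -> `|r - s| <= e.
Proof. by move=> ke sr rs; rewrite ler_norml; apply/andP; split; lra. Qed.

(** The perturbation bound, applied in both directions, confines the increment of the least
    eigenvalue to [K y], which tends to 0. *)
Lemma least_eigenvalue_continuous n (D : set R) (B : R -> 'M[C]_n) :
  (0 < n)%N -> (forall t, D t -> B t = (B t) ^t*) -> mx_continuous_in D B ->
  {within D, continuous (fun t => least_eigenvalue (B t))}.
Proof.
move=> n0 hB cB; apply/subspace_continuousP => x Dx.
pose K y := \sum_i \sum_j
  (`|complex.Re (B y i j - B x i j)| + `|complex.Im (B y i j - B x i j)|).
have cK : K y @[y --> within D (nbhs x)] --> (0 : R).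
  have -> : (0 : R) = K x.
    by rewrite /K big1 // => i _; rewrite big1 // => j _; rewrite subrr /= normr0 addr0.
  rewrite /K; apply: cvg_sumr => i _; apply: cvg_sumr => j _.
  have [/subspace_continuousP/(_ x Dx) cR /subspace_continuousP/(_ x Dx) cI] := cB i j.
  have ReB (z w : C) : complex.Re (z - w) = complex.Re z - complex.Re w by case: z w => ? ? [].
  have ImB (z w : C) : complex.Im (z - w) = complex.Im z - complex.Im w by case: z w => ? ? [].
  rewrite !ReB !ImB; under eq_fun do rewrite ReB ImB.
  by apply: cvgD; apply: cvg_norm; apply: cvgB => //; exact: cvg_cst.
have DF : \forall y \near within D (nbhs x), D y by exact: near_withinT.
apply/cvgrPdist_le => e e0.
have /cvgrPdist_le/(_ e e0) := cK.
apply: filterS2 DF => y Dy; rewrite sub0r normrN.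
have K0 : 0 <= K y.
  by rewrite /K sumr_ge0 // => i _; rewrite sumr_ge0 // => j _; rewrite addr_ge0.
rewrite ger0_norm // => Ke.
have h1 := least_eigenvalue_le _ _ _ n0 (hB _ Dy) (hB _ Dx).
have h2 := least_eigenvalue_le _ _ _ n0 (hB _ Dx) (hB _ Dy).
rewrite -/(K y) in h1.
have KE : \sum_i \sum_j (`|complex.Re (B x i j - B y i j)| +
    `|complex.Im (B x i j - B y i j)|) = K y.
  apply: eq_bigr => i _; apply: eq_bigr => j _.
  by case: (B x i j) (B y i j) => ? ? [] ? ? /=; rewrite distrC; congr (_ + _); rewrite distrC.
rewrite {}KE in h2; move: Ke h1 h2; move: (K y) => k.
move=> ke h1 h2; exact: ler_dist_trans ke h1 h2.
Qed.

(** The difference of the two sides is the sum of squared deviations from the mean [m]. *)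
Lemma sqr_sum_le n (x : 'I_n -> R) : (0 < n)%N ->
  (\sum_i x i) ^+ 2 / n%:R <= \sum_i x i ^+ 2.
Proof.
move=> n0; set S := \sum_i x i; pose m := S / n%:R.
have n0' : n%:R != 0 :> R by rewrite pnatr_eq0 -lt0n.
have : 0 <= \sum_i (x i - m) ^+ 2 by rewrite sumr_ge0 // => i _; rewrite sqr_ge0.
suff -> : \sum_i (x i - m) ^+ 2 = \sum_i x i ^+ 2 - S ^+ 2 / n%:R by rewrite subr_ge0.
have E i : (x i - m) ^+ 2 = x i ^+ 2 - 2 * m * x i + m ^+ 2 by ring.
under eq_bigr do rewrite E.
rewrite big_split /= sumrB -mulr_sumr -/S sumr_const card_ord -mulr_natr.
by rewrite /m; field.
Qed.

(** Since [Z] is hermitian, the [i]-th diagonal entry of [Z B Z] is the form of [B] at row [i] of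
    [Z]. The Rayleigh bound, restricted to the real part of the diagonal entry of that row, reduces
    the claim to [sqr_sum_le]. *)
Lemma trace_sandwich_ge n (Z B : 'M[C]_n) : (0 < n)%N ->
  Z = Z ^t* -> B = B ^t* -> 0 <= least_eigenvalue B ->
  least_eigenvalue B / n%:R * complex.Re (\tr Z) ^+ 2 <=
    complex.Re (\tr (Z *m B *m Z)).
Proof.
move=> n0 ZZ BB l0; have [_ ray] := least_eigenvalueP _ B n0 BB.
apply: (@le_trans _ _ (\sum_i least_eigenvalue B * complex.Re (Z i i) ^+ 2)).
  rewrite -mulr_sumr mulrAC -mulrA ler_wpM2l //.
  by rewrite /mxtrace Re_sum sqr_sum_le.
rewrite /mxtrace Re_sum; apply: ler_sum => i _.
have -> : (Z *m B *m Z) i i = (row i Z *m B *m (row i Z) ^t*) 0 0.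
  rewrite -row_mul {2}ZZ !mxE; apply: eq_bigr => j _.
  by rewrite !mxE.
have := ray (row i Z); rewrite lecE => /andP[_]; apply: le_trans.
rewrite dot_rowE.
have -> : \sum_j `|row i Z 0 j| ^+ 2 =
    (\sum_j (complex.Re (Z i j) ^+ 2 + complex.Im (Z i j) ^+ 2))%:C.
  by rewrite rmorph_sum /=; apply: eq_bigr => j _; rewrite add_Re2_Im2 mxE.
rewrite -rmorphM /= ler_wpM2l // (bigD1 i) //= -addrA lerDl.
by rewrite addr_ge0 ?sqr_ge0 // sumr_ge0 // => j _; rewrite addr_ge0 ?sqr_ge0.
Qed.

End least_eigenvalue.

(** * Differentiation of matrix functions *)

Section matrix_convergence.
Context {R : realType}.
Local Notation C := R[i].

(** Convergence by real and imaginary parts, to match the encoding of [mx_is_derive_in] and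
    [mx_continuous_in]. *)
Definition cvgc {T : Type} (F : set_system T) (f : T -> C) (l : C) : Prop :=
  (complex.Re (f t) @[t --> F] --> complex.Re l) /\
  (complex.Im (f t) @[t --> F] --> complex.Im l).

Definition mx_cvg {T : Type} (F : set_system T) {m n} (M : T -> 'M[C]_(m, n))
    (L : 'M[C]_(m, n)) : Prop :=
  forall i j, cvgc F (fun t => M t i j) (L i j).

Section cvgc.
Context {T : Type} {F : set_system T} {FF : Filter F}.
Implicit Types (f g : T -> C).

Lemma ReD (z w : C) : complex.Re (z + w) = complex.Re z + complex.Re w.
Proof. by case: z w => ? ? []. Qed.
Lemma ImD (z w : C) : complex.Im (z + w) = complex.Im z + complex.Im w.
Proof. by case: z w => ? ? []. Qed.
Lemma ReM (z w : C) : complex.Re (z * w) =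
  complex.Re z * complex.Re w - complex.Im z * complex.Im w.
Proof. by case: z w => ? ? []. Qed.
Lemma ImM (z w : C) : complex.Im (z * w) =
  complex.Re z * complex.Im w + complex.Im z * complex.Re w.
Proof. by case: z w => ? ? []. Qed.
Lemma ReN (z : C) : complex.Re (- z) = - complex.Re z.
Proof. by case: z. Qed.
Lemma Re_conj (z : C) : complex.Re (z^*)%R = complex.Re z.
Proof. by case: z. Qed.
Lemma Im_conj (z : C) : complex.Im (z^*)%R = - complex.Im z.
Proof. by case: z. Qed.

Lemma cvgc_cst (l : C) : cvgc F (fun=> l) l.
Proof. by split; exact: cvg_cst. Qed.

Lemma cvgcD f g (l m : C) : cvgc F f l -> cvgc F g m -> cvgc F (fun t => f t + g t) (l + m).
Proof.
move=> [fr fi] [gr gi]; split.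
  by rewrite ReD; under eq_fun do rewrite ReD; exact: cvgD.
by rewrite ImD; under eq_fun do rewrite ImD; exact: cvgD.
Qed.

Lemma cvgcM f g (l m : C) : cvgc F f l -> cvgc F g m -> cvgc F (fun t => f t * g t) (l * m).
Proof.
move=> [fr fi] [gr gi]; split.
  by rewrite ReM; under eq_fun do rewrite ReM; apply: cvgB; exact: cvgM.
by rewrite ImM; under eq_fun do rewrite ImM; apply: cvgD; exact: cvgM.
Qed.

Lemma cvgc_conj f (l : C) : cvgc F f l -> cvgc F (fun t => (f t)^*%R) (l^*)%R.
Proof.
move=> [fr fi]; split.
  by rewrite Re_conj; under eq_fun do rewrite Re_conj.
by rewrite Im_conj; under eq_fun do rewrite Im_conj; exact: cvgN.
Qed.

Lemma cvgc_sum (I : Type) (r : seq I) (P : pred I) (f : I -> T -> C) (l : I -> C) :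
  (forall i, cvgc F (f i) (l i)) ->
  cvgc F (fun t => \sum_(i <- r | P i) f i t) (\sum_(i <- r | P i) l i).
Proof.
move=> fl; split.
  by rewrite Re_sum; under eq_fun do rewrite Re_sum; apply: cvg_sumr => i _; case: (fl i).
by rewrite Im_sum; under eq_fun do rewrite Im_sum; apply: cvg_sumr => i _; case: (fl i).
Qed.

Lemma cvgc_prod (I : Type) (r : seq I) (f : I -> T -> C) (l : I -> C) :
  (forall i, cvgc F (f i) (l i)) ->
  cvgc F (fun t => \prod_(i <- r) f i t) (\prod_(i <- r) l i).
Proof.
move=> fl; elim: r => [|i r IH].
  by rewrite big_nil; under eq_fun do rewrite big_nil; exact: cvgc_cst.
by rewrite big_cons; under eq_fun do rewrite big_cons; exact: cvgcM.
Qed.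

Lemma cvgc_inv f (l : C) : l != 0 -> cvgc F f l -> cvgc F (fun t => (f t)^-1) l^-1.
Proof.
move=> l0 [fr fi].
have ReV (z : C) : complex.Re z^-1 =
    complex.Re z / (complex.Re z ^+ 2 + complex.Im z ^+ 2) by case: z.
have ImV (z : C) : complex.Im z^-1 =
    - (complex.Im z / (complex.Re z ^+ 2 + complex.Im z ^+ 2)) by case: z.
have s0 : complex.Re l ^+ 2 + complex.Im l ^+ 2 != 0.
  by rewrite -(inj_eq (@complexI R)) add_Re2_Im2 expf_eq0 /= normr_eq0.
have cs : (complex.Re (f t) ^+ 2 + complex.Im (f t) ^+ 2)^-1 @[t --> F] -->
    (complex.Re l ^+ 2 + complex.Im l ^+ 2)^-1.
  by apply: cvgV => //; apply: cvgD; exact: cvgM.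
split.
  by rewrite ReV; under eq_fun do rewrite ReV; exact: cvgM.
by rewrite ImV; under eq_fun do rewrite ImV; apply: cvgN; exact: cvgM.
Qed.

Lemma near_eq_cvgc f g (l : C) : (\forall t \near F, f t = g t) -> cvgc F f l -> cvgc F g l.
Proof.
move=> fg [fr fi]; split.
  by apply: cvg_trans fr; apply: near_eq_cvg; apply: filterS fg => t ->.
by apply: cvg_trans fi; apply: near_eq_cvg; apply: filterS fg => t ->.
Qed.

Lemma mx_cvg_cst m n (L : 'M[C]_(m, n)) : mx_cvg F (fun=> L) L.
Proof. by move=> i j; exact: cvgc_cst. Qed.

Lemma mx_cvgD m n (M N : T -> 'M[C]_(m, n)) L K :
  mx_cvg F M L -> mx_cvg F N K -> mx_cvg F (fun t => M t + N t) (L + K).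
Proof.
move=> ML NK i j; rewrite mxE; under eq_fun do rewrite mxE.
exact: cvgcD.
Qed.

Lemma mx_cvgM m n p (M : T -> 'M[C]_(m, n)) (N : T -> 'M[C]_(n, p)) L K :
  mx_cvg F M L -> mx_cvg F N K -> mx_cvg F (fun t => M t *m N t) (L *m K).
Proof.
move=> ML NK i j; rewrite mxE; under eq_fun do rewrite mxE.
by apply: cvgc_sum => k; exact: cvgcM.
Qed.

Lemma mx_cvgN m n (M : T -> 'M[C]_(m, n)) L :
  mx_cvg F M L -> mx_cvg F (fun t => - M t) (- L).
Proof.
move=> ML i j; rewrite mxE -mulN1r; under eq_fun do rewrite mxE -mulN1r.
by apply: cvgcM => //; exact: cvgc_cst.
Qed.

Lemma mx_cvg_conjT m n (M : T -> 'M[C]_(m, n)) L :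
  mx_cvg F M L -> mx_cvg F (fun t => (M t) ^t*) (L ^t*).
Proof.
move=> ML i j; rewrite !mxE; under eq_fun do rewrite !mxE.
exact: cvgc_conj.
Qed.

Lemma cvgc_det n (M : T -> 'M[C]_n) L :
  mx_cvg F M L -> cvgc F (fun t => \det (M t)) (\det L).
Proof.
move=> ML; apply: cvgc_sum => s; apply: cvgcM; first exact: cvgc_cst.
by apply: cvgc_prod => i.
Qed.

Lemma mx_cvg_adj n (M : T -> 'M[C]_n) L :
  mx_cvg F M L -> mx_cvg F (fun t => \adj (M t)) (\adj L).
Proof.
move=> ML i j; rewrite mxE; under eq_fun do rewrite mxE.
apply: cvgcM; first exact: cvgc_cst.
apply: cvgc_det => k l; rewrite !mxE; under eq_fun do rewrite !mxE.
exact: ML.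
Qed.

(** By Cramer's formula the inverse is built from determinants. Invertibility along [F] is assumed
    because [invmx] returns its argument on singular matrices. *)
Lemma mx_cvg_inv n (M : T -> 'M[C]_n) L : L \in unitmx ->
  (\forall t \near F, M t \in unitmx) ->
  mx_cvg F M L -> mx_cvg F (fun t => invmx (M t)) (invmx L).
Proof.
move=> Lu Mu ML i j; rewrite /invmx Lu mxE.
apply: (@near_eq_cvgc (fun t => (\det (M t))^-1 * (\adj (M t)) i j)).
  by apply: filterS Mu => t ->; rewrite [RHS]mxE.
apply: cvgcM; last exact: mx_cvg_adj.
by apply: cvgc_inv; [rewrite -unitfE|exact: cvgc_det].
Qed.

Lemma cvg_Re_trace n (M : T -> 'M[C]_n) L : mx_cvg F M L ->
  complex.Re (\tr (M t)) @[t --> F] --> complex.Re (\tr L).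
Proof.
by move=> ML; have [] := @cvgc_sum _ (index_enum 'I_n) xpredT (fun i t => M t i i)
  (fun i => L i i) (fun i => ML i i).
Qed.

End cvgc.

Implicit Type D : set R.

(** Replaces componentwise derivatives by one limit of matrix difference quotients, open to matrix
    algebra. *)
Lemma mx_is_derive_inP m n D (G : R -> 'M[C]_(m, n)) x L :
  mx_is_derive_in D G x L <->
  mx_cvg (within D x^') (fun y => ((y - x)^-1)%:C *: (G y - G x)) L.
Proof.
have E (r : R) (z w : C) : complex.Re (r%:C * (z - w)) = (complex.Re z - complex.Re w) * r /\
    complex.Im (r%:C * (z - w)) = (complex.Im z - complex.Im w) * r.
  by case: z w => ? ? [? ?] /=; split; ring.
have ER i j y : complex.Re ((((y - x)^-1)%:C *: (G y - G x)) i j) =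
    (complex.Re (G y i j) - complex.Re (G x i j)) / (y - x).
  by rewrite !mxE; have [-> _] := E (y - x)^-1 (G y i j) (G x i j).
have EI i j y : complex.Im ((((y - x)^-1)%:C *: (G y - G x)) i j) =
    (complex.Im (G y i j) - complex.Im (G x i j)) / (y - x).
  by rewrite !mxE; have [_ ->] := E (y - x)^-1 (G y i j) (G x i j).
rewrite /mx_is_derive_in /mx_cvg /cvgc /is_derive_in.
split=> H i j; have [Hr Hi] := H i j; split.
- by under eq_fun do rewrite ER.
- by under eq_fun do rewrite EI.
- by move: Hr; under eq_fun do rewrite ER.
- by move: Hi; under eq_fun do rewrite EI.
Qed.

Lemma mx_is_derive_in_cvg m n D (G : R -> 'M[C]_(m, n)) x L :
  mx_is_derive_in D G x L -> mx_cvg (within D (nbhs x)) G (G x).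
Proof.
move=> dG i j; have [dr di] := dG i j.
split; [exact: is_derive_in_continuous dr|exact: is_derive_in_continuous di].
Qed.

Lemma mx_is_derive_in_dnbhs_cvg m n D (G : R -> 'M[C]_(m, n)) x L :
  mx_is_derive_in D G x L -> mx_cvg (within D x^') G (G x).
Proof.
move=> dG i j; have [dr di] := dG i j.
split; [exact: is_derive_in_cvg dr|exact: is_derive_in_cvg di].
Qed.

Lemma mx_is_derive_inW m n D D' (G : R -> 'M[C]_(m, n)) x L : D `<=` D' ->
  mx_is_derive_in D' G x L -> mx_is_derive_in D G x L.
Proof.
move=> DD' dG i j; have [dr di] := dG i j.
split; [exact: is_derive_inW dr|exact: is_derive_inW di].
Qed.

Lemma mx_is_derive_inB m n D (G H : R -> 'M[C]_(m, n)) x L K :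
  mx_is_derive_in D G x L -> mx_is_derive_in D H x K ->
  mx_is_derive_in D (fun t => G t - H t) x (L - K).
Proof.
move=> /mx_is_derive_inP dG /mx_is_derive_inP dH; apply/mx_is_derive_inP.
have E y : ((y - x)^-1)%:C *: (G y - H y - (G x - H x)) =
    ((y - x)^-1)%:C *: (G y - G x) - ((y - x)^-1)%:C *: (H y - H x).
  by rewrite -scalerBr; congr (_ *: _); rewrite !opprD !opprK addrACA.
under eq_fun do rewrite E.
by apply: mx_cvgD => //; exact: mx_cvgN.
Qed.

Lemma is_derive_in_Re_trace n D (G : R -> 'M[C]_n) x L :
  mx_is_derive_in D G x L ->
  is_derive_in D (fun t => complex.Re (\tr (G t))) x (complex.Re (\tr L)).
Proof.
move=> /mx_is_derive_inP/cvg_Re_trace; rewrite /is_derive_in.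
have E y : complex.Re (\tr (((y - x)^-1)%:C *: (G y - G x))) =
    (complex.Re (\tr (G y)) - complex.Re (\tr (G x))) / (y - x).
  rewrite mxtraceZ raddfB /= ReM /= mul0r subr0 mulrC.
  by rewrite ReD ReN.
by under eq_fun do rewrite E.
Qed.

Lemma mx_continuous_in_cvg m n D (G : R -> 'M[C]_(m, n)) x :
  mx_continuous_in D G -> D x -> mx_cvg (within D (nbhs x)) G (G x).
Proof.
move=> cG Dx i j.
by have [/subspace_continuousP/(_ x Dx) ? /subspace_continuousP/(_ x Dx) ?] := cG i j.
Qed.

Lemma mx_continuous_inW m n D D' (G : R -> 'M[C]_(m, n)) : D `<=` D' ->
  mx_continuous_in D' G -> mx_continuous_in D G.
Proof.
move=> DD' cG i j; have [cr ci] := cG i j.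
by split; exact: continuous_subspaceW DD' _.
Qed.

End matrix_convergence.

(** * Algebra of the Riccati quotient *)

Section quotient_algebra.
Context {F : comUnitRingType} {n : nat}.
Implicit Types A B C P Q S Y Z : 'M[F]_n.

(** Meant for [P], [Q] the values of [Phi], [Psi] at [x], with [p'], [q'] their conjugate transposes
    and [P'], [Q'] those at [y]. Preparedness at [x] is [q' *m P = p' *m Q], and it cancels the
    terms in [p'] and [q']. *)
Lemma quotient_increment P P' Q Q' p' q' : P \in unitmx -> P' \in unitmx ->
  q' *m P = p' *m Q ->
  invmx P' *m ((Q' - q') *m P - (P' - p') *m Q) *m invmx P =
  invmx P' *m Q' - Q *m invmx P.
Proof.
move=> Pu Pu' qp; rewrite !mulmxBl qp opprB addrA subrK mulmxBr mulmxBl.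
by rewrite !mulmxA mulmxK // mulVmx // mul1mx.
Qed.

(** [Y] is both a left and a right quotient, so the outer inverses are absorbed one on each side. *)
Lemma riccati_quotient A A' B C P P' Q Q' Y : P \in unitmx -> P' \in unitmx ->
  invmx P' *m Q' = Y -> Q *m invmx P = Y ->
  invmx P' *m ((P' *m C - Q' *m A) *m P - (P' *m A' + Q' *m B) *m Q) *m invmx P =
  C - Y *m A - A' *m Y - Y *m B *m Y.
Proof.
move=> Pu Pu' YE' YE.
have T1 : invmx P' *m (P' *m C - Q' *m A) = C - Y *m A.
  by rewrite mulmxBr mulKmx // mulmxA YE'.
have T2 : invmx P' *m (P' *m A' + Q' *m B) = A' + Y *m B.
  by rewrite mulmxDr mulKmx // mulmxA YE'.
rewrite mulmxBr !mulmxA T1 T2 mulmxBl mulmxK // -[X in _ - X]mulmxA YE mulmxDl.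
by rewrite opprD addrA.
Qed.

(** Put [Y = Z + S]. By cyclicity of the trace the terms linear in [Z] add up to the trace of
    [Z (A + A' + B S + S B)], which the hypothesis makes [m] times the trace of [Z]. *)
Lemma riccati_trace A A' B C S Y dS (m : F) :
  B *m S + S *m B = m%:M - A - A' ->
  \tr (C - Y *m A - A' *m Y - Y *m B *m Y - dS) =
  - (m * \tr (Y - S)) - \tr ((Y - S) *m B *m (Y - S)) -
  \tr (dS + S *m B *m S + A' *m S + S *m A - C).
Proof.
move=> Seq; have YE : Y = (Y - S) + S by rewrite subrK.
move: (Y - S) YE => Z YE.
have trZ : \tr (Z *m A) + \tr (A' *m Z) + \tr (Z *m B *m S) + \tr (S *m B *m Z) =
    m * \tr Z.
  rewrite (mxtrace_mulC A') (mxtrace_mulC (S *m B)) -mulmxA.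
  rewrite -!mxtraceD -!mulmxDr -addrA Seq.
  have -> : A + A' + (m%:M - A - A') = m%:M.
    by rewrite addrACA subrr addr0 addrC subrK.
  by rewrite mul_mx_scalar mxtraceZ.
have E1 : \tr (Y *m A) = \tr (Z *m A) + \tr (S *m A).
  by rewrite YE mulmxDl mxtraceD.
have E2 : \tr (A' *m Y) = \tr (A' *m Z) + \tr (A' *m S).
  by rewrite YE mulmxDr mxtraceD.
have E3 : \tr (Y *m B *m Y) = \tr (Z *m B *m Z) + \tr (S *m B *m Z) +
    (\tr (Z *m B *m S) + \tr (S *m B *m S)).
  by rewrite YE mulmxDl mulmxDr !mulmxDl !mxtraceD.
have trB (M N : 'M[F]_n) : \tr (M - N) = \tr M - \tr N by rewrite raddfB.
rewrite !trB !mxtraceD E1 E2 E3 -trZ; ring.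
Qed.

End quotient_algebra.

(** * The Riccati equation of a prepared solution *)

Section riccati.
Context {R : realType}.

Lemma conjT_mul m n p (M : 'M[R[i]]_(m, n)) (N : 'M[R[i]]_(n, p)) :
  (M *m N) ^t* = N ^t* *m M ^t*.
Proof. by rewrite trmx_mul map_mxM. Qed.

Lemma conjTB m n (M N : 'M[R[i]]_(m, n)) : (M - N) ^t* = M ^t* - N ^t*.
Proof. by rewrite raddfB /= map_mxB. Qed.

Lemma conjTD m n (M N : 'M[R[i]]_(m, n)) : (M + N) ^t* = M ^t* + N ^t*.
Proof. by rewrite raddfD /= map_mxD. Qed.

Lemma conjT_inv n (M : 'M[R[i]]_n) : (invmx M) ^t* = invmx (M ^t*).
Proof. by rewrite trmx_inv map_invmx. Qed.

Lemma conjT_unit n (M : 'M[R[i]]_n) : (M ^t* \in unitmx) = (M \in unitmx).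
Proof. by rewrite map_unitmx unitmx_tr. Qed.

Lemma conjT_scale_real m n (r : R) (M : 'M[R[i]]_(m, n)) :
  (r%:C *: M) ^t* = r%:C *: M ^t*.
Proof.
by apply/matrixP => i j; rewrite !mxE rmorphM /=; congr (_ * _); exact: conjc_real.
Qed.

Lemma prepared_quotient_hermitian n (Phi Psi : 'M[R[i]]_n) : Phi \in unitmx ->
  Phi ^t* *m Psi = Psi ^t* *m Phi -> (Psi *m invmx Phi) ^t* = Psi *m invmx Phi.
Proof.
move=> Pu prep; rewrite conjT_mul conjT_inv.
by rewrite -[Psi ^t*](mulmxK Pu) -prep !mulmxA mulVmx ?conjT_unit // mul1mx.
Qed.

(* Since [Psi Phi^-1] is hermitian, its increment between [x] and [y] is
   [Phi(y)^-* (Psi(y)^* Phi(x) - Phi(y)^* Psi(x)) Phi(x)^-1], so that the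
   derivative of the inverse is not needed. *)
Lemma prepared_quotient_derive n (D : set R) (Phi Psi : R -> 'M[R[i]]_n) x dPhi dPsi :
  D x -> (forall t, D t -> Phi t \in unitmx) ->
  (forall t, D t -> (Phi t) ^t* *m Psi t = (Psi t) ^t* *m Phi t) ->
  mx_is_derive_in D Phi x dPhi -> mx_is_derive_in D Psi x dPsi ->
  mx_is_derive_in D (fun t => Psi t *m invmx (Phi t)) x
    (invmx ((Phi x) ^t*) *m (dPsi ^t* *m Phi x - dPhi ^t* *m Psi x) *m invmx (Phi x)).
Proof.
move=> Dx Pu prep dP dQ; apply/mx_is_derive_inP.
have cP := mx_is_derive_in_dnbhs_cvg _ _ _ _ _ _ dP.
have /mx_is_derive_inP dP' := dP; have /mx_is_derive_inP dQ' := dQ.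
have nearD : \forall t \near within D x^', D t by exact: near_withinT.
pose q y : R[i] := ((y - x)^-1)%:C.
have E y : D y -> q y *: (Psi y *m invmx (Phi y) - Psi x *m invmx (Phi x)) =
    invmx ((Phi y) ^t*) *m ((q y *: (Psi y - Psi x)) ^t* *m Phi x -
      (q y *: (Phi y - Phi x)) ^t* *m Psi x) *m invmx (Phi x).
  move=> Dy.
  rewrite !conjT_scale_real -!scalemxAl -scalerBr -scalemxAr -scalemxAl.
  congr (_ *: _).
  rewrite !conjTB quotient_increment ?conjT_unit ?Pu ?prep //.
  rewrite -[in LHS](prepared_quotient_hermitian _ _ _ (Pu _ Dy) (prep _ Dy)).
  by rewrite conjT_mul conjT_inv.
have H : mx_cvg (within D x^')
    (fun y => invmx ((Phi y) ^t*) *m ((q y *: (Psi y - Psi x)) ^t* *m Phi x -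
      (q y *: (Phi y - Phi x)) ^t* *m Psi x) *m invmx (Phi x))
    (invmx ((Phi x) ^t*) *m (dPsi ^t* *m Phi x - dPhi ^t* *m Psi x) *m invmx (Phi x)).
  apply: mx_cvgM; last exact: mx_cvg_cst.
  apply: mx_cvgM.
    apply: mx_cvg_inv; first by rewrite conjT_unit Pu.
      by apply: filterS nearD => t Dt; rewrite conjT_unit Pu.
    exact: mx_cvg_conjT.
  apply: mx_cvgD.
    by apply: mx_cvgM; [exact: mx_cvg_conjT|exact: mx_cvg_cst].
  apply: mx_cvgN.
  by apply: mx_cvgM; [exact: mx_cvg_conjT|exact: mx_cvg_cst].
move=> i j; apply: near_eq_cvgc (H i j).
by apply: filterS nearD => y Dy; rewrite -E.
Qed.

(** Evaluates the derivative from [prepared_quotient_derive] along the hamiltonian system: it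
    becomes the right-hand side of the Riccati equation. *)
Lemma riccati_rhs n (A B C Phi Psi : 'M[R[i]]_n) : Phi \in unitmx ->
  Phi ^t* *m Psi = Psi ^t* *m Phi -> B = B ^t* -> C = C ^t* ->
  let Y := Psi *m invmx Phi in
  invmx (Phi ^t*) *m ((C *m Phi - A ^t* *m Psi) ^t* *m Phi -
    (A *m Phi + B *m Psi) ^t* *m Psi) *m invmx Phi =
  C - Y *m A - A ^t* *m Y - Y *m B *m Y.
Proof.
move=> Pu prep BB CC Y.
have YE : invmx (Phi ^t*) *m Psi ^t* = Y.
  by rewrite /Y -(prepared_quotient_hermitian _ _ _ Pu prep) conjT_mul conjT_inv.
have Pu' : Phi ^t* \in unitmx by rewrite conjT_unit.
rewrite conjTB conjTD !conjT_mul trmxCK -BB -CC.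
exact: riccati_quotient.
Qed.

End riccati.

(* [D_mx A B C S dS t] is hermitian, so its trace is real; [complex.Re] only
   turns it into an element of [R]. *)
Theorem theorem2p2 (R : realType) (n : nat) (n_gt0 : (0 < n)%N)
    (t0 a b : R) (t0a : t0 <= a) (ab : a < b)
    (A B C : R -> 'M[R[i]]_n) (mu : R -> R)
    (contA : mx_continuous_in `[t0, +oo[ A)
    (contB : mx_continuous_in `[t0, +oo[ B)
    (contC : mx_continuous_in `[t0, +oo[ C)
    (hermB : forall t, t0 <= t -> B t = (B t) ^t*)
    (hermC : forall t, t0 <= t -> C t = (C t) ^t*)
    (contmu : {within `[t0, +oo[, continuous mu})
    (B_ge0 : forall t, t \in `[a, b] -> nonneg_definite (B t))
    (S dS : R -> 'M[R[i]]_n)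
    (S_C1 : mx_C1_in `[a, b] S dS)
    (hermS : forall t, t \in `[a, b] -> S t = (S t) ^t*)
    (S_eq : forall t, t \in `[a, b] ->
      B t *m S t + S t *m B t = (2 * mu t)%:C%:M - A t - (A t) ^t*)
    (osc : scalar_oscillatory a b
      mu
      (fun t => least_eigenvalue (B t) / n%:R)
      (fun t => - complex.Re (\tr (D_mx A B C S dS t)))
      (fun t => - mu t)) :
  ham_oscillatory t0 A B C a b.
Proof.
move=> Phi Psi [[dPhi _] [dPsi _]] prep; apply: contrapT => nosc.
have sub : `[a, b] `<=` `[t0, +oo[.
  move=> t; rewrite /= !in_itv /= andbT => /andP[at_ _]; exact: le_trans at_.
have t0t t : t \in `[a, b] -> t0 <= t.
  by move=> /sub /=; rewrite in_itv /= andbT.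
have Pu t : `[a, b]%classic t -> Phi t \in unitmx.
  move=> tab; rewrite unitmxE unitfE; apply/eqP => det0.
  by apply: nosc; exists t.
have prep' t : `[a, b]%classic t -> (Phi t) ^t* *m Psi t = (Psi t) ^t* *m Phi t.
  by move=> /t0t; exact: prep.
have [dS_ _] := S_C1.
pose Y t := Psi t *m invmx (Phi t).
pose Z t := Y t - S t.
have YH t : t \in `[a, b] -> Y t = (Y t) ^t*.
  by move=> tab; rewrite [RHS](prepared_quotient_hermitian _ _ _ (Pu t tab) (prep' t tab)).
have ZH t : t \in `[a, b] -> Z t = (Z t) ^t*.
  by move=> tab; rewrite /Z conjTB -YH // -hermS.
have dZ t : t \in `[a, b] -> mx_is_derive_in `[a, b] Z t
    (C t - Y t *m A t - (A t) ^t* *m Y t - Y t *m B t *m Y t - dS t).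
  move=> tab; apply: mx_is_derive_inB; last exact: dS_.
  rewrite -(riccati_rhs _ _ _ _ _ _ (Pu t tab) (prep' t tab) (hermB t (t0t t tab))
    (hermC t (t0t t tab))).
  apply: prepared_quotient_derive => //.
    exact: (mx_is_derive_inW _ _ _ _ _ _ _ sub (dPhi t (sub t tab))).
  exact: (mx_is_derive_inW _ _ _ _ _ _ _ sub (dPsi t (sub t tab))).
pose z t := complex.Re (\tr (Z t)).
pose q t := least_eigenvalue (B t) / n%:R.
pose d t := complex.Re (\tr (D_mx A B C S dS t)).
(* The slack in the trace estimate: with it the Riccati inequality for [z] becomes an equation with
   a nonnegative continuous extra term. *)
pose e t := complex.Re (\tr (Z t *m B t *m Z t)) - q t * z t ^+ 2.
have l0 t : t \in `[a, b] -> 0 <= least_eigenvalue (B t).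
  by move=> tab; apply: least_eigenvalue_ge0 => //; [exact/hermB/t0t|exact: B_ge0].
have q0 t : t \in `[a, b] -> 0 <= q t.
  by move=> tab; rewrite divr_ge0 ?l0.
have e0 t : t \in `[a, b] -> 0 <= e t.
  move=> tab; rewrite subr_ge0; apply: trace_sandwich_ge => //; last exact: l0.
    exact: ZH.
  exact/hermB/t0t.
have dz t : t \in `[a, b] -> is_derive_in `[a, b] z t
    (- (2 * mu t * z t) - q t * z t ^+ 2 - d t - e t).
  move=> tab; have := is_derive_in_Re_trace _ _ _ _ _ (dZ t tab).
  apply: eq_is_derive_in.
  (* Here [m] is the real number [2 * mu t], so the real part of its product with the trace of [Z t]
     is [2 * mu t * z t]. *)
  rewrite (riccati_trace _ _ _ _ _ _ _ _ (S_eq t tab)) -/(D_mx A B C S dS t) -/(Z t).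
  rewrite !(ReD, ReN) ReM /= mul0r subr0 -/(z t) -/(d t) /e; ring.
have contB' : mx_continuous_in `[a, b] B := mx_continuous_inW _ _ _ _ _ sub contB.
have cl : {within `[a, b], continuous (fun t => least_eigenvalue (B t))}.
  by apply: least_eigenvalue_continuous => // t tab; exact/hermB/t0t.
have cq : {within `[a, b], continuous q}.
  by move=> t; apply: cvgM; [exact: cl|exact: cvg_cst].
have cz : {within `[a, b], continuous z}.
  by apply/subspace_continuousP => t tab; apply: is_derive_in_continuous (dz t tab).
have cZBZ : {within `[a, b], continuous (fun t => complex.Re (\tr (Z t *m B t *m Z t)))}.
  apply/subspace_continuousP => t tab; apply: cvg_Re_trace.
  have cZ := mx_is_derive_in_cvg _ _ _ _ _ _ (dZ t tab).
  apply: mx_cvgM => //; apply: mx_cvgM => //.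
  exact: mx_continuous_in_cvg.
have ce : {within `[a, b], continuous e}.
  have cqz := within_continuousM _ _ _ cq (within_continuousM _ _ _ cz cz).
  by move=> t; apply: cvgB; [exact: cZBZ|exact: cqz].
have cmu : {within `[a, b], continuous mu} := continuous_subspaceW sub contmu.
(* A solution with [phi] positive on all of [[a, b]] contradicts [osc]. *)
have [phi [psi [sol phi0]]] :=
  riccati_inequality_positive_solution _ _ _ _ _ _ _ (ltW ab) cmu cq ce q0 e0 dz.
have [t tab phit] := osc phi psi sol.
by have := phi0 t tab; rewrite phit ltxx.
Qed.
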